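(* Fix $t>0$. The set $\Delta_{t,\mu}$ is invariant under $\lambda\mapsto1/\bar\lambda$, and $$\Delta_{t,\mu}=\{\lambda\in\mathbb C\setminus\{0\}: T(\lambda)<t\}.$$ Moreover, $T(\lambda)>t$ for every $\lambda\in\mathbb C\setminus(\overline{\Delta_{t,\mu}}\cup\{0\})$; $T(\lambda)\ge t$ for every $\lambda\in\partial\Delta_{t,\mu}\cap\mathbb T$; and $T(\lambda)=t$ for every $\lambda\in\partial\Delta_{t,\mu}\setminus\mathbb T$.
   Context: Let $\mu$ be a Borel probability measure on $\mathbb T$. For $r\in(0,\infty)\setminus\{1\}$ and $\theta\in\mathbb R$ let $f(r,\theta)=\frac12\frac{1-r^2}{-\log r}\int_{-\pi}^{\pi}\frac{d\mu(e^{ix})}{|1-re^{i(\theta-x)}|^2}$, and let $f(1^-,\theta)=\int_{-\pi}^{\pi}\frac{d\mu(e^{ix})}{|1-e^{i(\theta-x)}|^2}\in(0,\infty]$. Define $T:\mathbb C\setminus\{0\}\to[0,\infty)$ by $T(re^{i\theta})=1/f(r,\theta)$ if $r\ne1$ and $T(e^{i\theta})=1/f(1^-,\theta)$ (with $1/\infty=0$). Fix $t>0$; let $r_t(\theta)=\sup\{0<r<1: f(r,\theta)<\frac1t\}\in(0,1]$, $U_t=\{\theta\in(-\pi,\pi]: f(1^-,\theta)>\frac1t\}$, and $\Delta_{t,\mu}=\{re^{i\theta}:\theta\in U_t,\ r_t(\theta)<r<1/r_t(\theta)\}$. *)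

(* Defs.v *)
From HB Require Import structures.
From mathcomp Require Import all_boot all_order all_algebra.
From mathcomp Require Import all_classical all_reals all_analysis.
From mathcomp Require Import complex.
Set Implicit Arguments. Unset Strict Implicit. Unset Printing Implicit Defensive.
Import Order.TTheory GRing.Theory Num.Theory.
Import numFieldTopology.Exports numFieldNormedType.Exports.
Local Open Scope classical_set_scope.
Local Open Scope ring_scope.
Local Open Scope complex_scope.

Definition expi (R : realType) (x : R) : R[i] := (cos x +i* sin x).

Definition pkernel (R : realType) (lam : R[i]) (x : R) : \bar R :=
  let d := Normc.normc (1 - lam * expi (- x)) in
  if d == 0 then +oo%E else ((d ^+ 2)^-1)%:E.

Definition angles (R : realType) : set R := `]-pi, pi].

(* Integral  int_{-pi}^{pi} dmu(e^{ix}) / |1 - lam e^{-ix}|^2 ; the measure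
   mu on T is represented by its pushforward on the angle x in (-pi, pi]. *)
Definition Pint (R : realType) (mu : probability R R) (lam : R[i]) : \bar R :=
  (\int[mu]_(x in @angles R) pkernel lam x)%E.

Definition pcoef (R : realType) (r : R) : R := 2^-1 * ((1 - r ^+ 2) / (- ln r)).

Definition fmu (R : realType) (mu : probability R R) (r theta : R) : \bar R :=
  ((pcoef r)%:E * Pint mu (r%:C * expi theta)%R)%E.

Definition f1mu (R : realType) (mu : probability R R) (theta : R) : \bar R :=
  Pint mu (expi theta).

Definition einv (R : realType) (e : \bar R) : R :=
  match e with EFin r => r^-1 | _ => 0 end.

(* T(lam) for lam <> 0: with lam = r e^{i theta}, r = |lam|,
   T = 1/f(r, theta) if r <> 1 and T = 1/f(1^-, theta) if r = 1. *)
Definition Tmu (R : realType) (mu : probability R R) (lam : R[i]) : R :=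
  let r := Normc.normc lam in
  if r == 1 then einv (Pint mu lam) else einv ((pcoef r)%:E * Pint mu lam)%E.

Definition rt (R : realType) (mu : probability R R) (t theta : R) : R :=
  sup [set r : R | 0 < r < 1 /\ (fmu mu r theta < (t^-1)%:E)%E].

Definition Ut (R : realType) (mu : probability R R) (t : R) : set R :=
  [set theta : R | -pi < theta <= pi /\ ((t^-1)%:E < f1mu mu theta)%E].

Definition Delta (R : realType) (mu : probability R R) (t : R) : set R[i] :=
  [set lam : R[i] | exists theta r : R, Ut mu t theta /\
     rt mu t theta < r < (rt mu t theta)^-1 /\ lam = r%:C * expi theta].

Definition boundary (T : topologicalType) (A : set T) : set T :=
  closure A `\` interior A.

(* the complex numbers R[i] viewed as a numClosedFieldType, so that they
   carry the (norm-induced) topology of MathComp-Analysis *)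
Definition Cplx (R : realType) : numClosedFieldType := R[i].

(* Main.v *)
(* The kernel of f(r, th) factors as
     wgt r / (1 + r)^2 * ((1 + r)^2 / |1 - r e^(i(th - x))|^2),
   where wgt is pcoef with wgt 1 = 1. On (0, 1] the first factor is strictly
   increasing and the second is nondecreasing, so r |-> f(r, th) is strictly
   increasing; it tends to 0 as r -> 0, to f(1^-, th) as r -> 1 by monotone
   convergence, and is invariant under r |-> 1/r. This identifies Delta with
   {T < t}, and the statements off the unit circle follow from continuity of
   T there and from strict monotonicity.

   On the circle, T may be discontinuous, and one has to show that
   T(e^(i th)) = t forces e^(i th) into the closure of {T < t}. Otherwise
   f(1^-, .) <= M = 1/t on an arc of half-width d around th. This makes the arc
   mu-null, and off the arc the kernels satisfy
     k(th + d - x) + k(th - d - x) >= 2 q k(th - x)  with q > 1;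
   integrating, 2 M >= 2 q M, a contradiction. *)
Require Import Defs.
From HB Require Import structures.
From mathcomp Require Import all_boot all_order all_algebra.
From mathcomp Require Import all_classical all_reals all_analysis.
From mathcomp Require Import complex measurable_realfun ring lra.
Import Order.TTheory GRing.Theory Num.Theory.
Import numFieldTopology.Exports numFieldNormedType.Exports.
Local Open Scope classical_set_scope.
Local Open Scope ring_scope.
Local Open Scope complex_scope.

(** * Modulus, unit vectors and polar form *)

Lemma normc_expi {R : realType} (x : R) : Normc.normc (expi x) = 1.
Proof. by rewrite /Normc.normc /expi cos2Dsin2 sqrtr1. Qed.

Lemma normc_real {R : realType} (r : R) : Normc.normc r%:C = `|r|.
Proof. by rewrite /Normc.normc /= expr0n addr0 sqrtr_sqr. Qed.

Lemma normc_polar {R : realType} (r x : R) :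
  0 <= r -> Normc.normc (r%:C * expi x) = r.
Proof. by move=> r0; rewrite Normc.normcM normc_expi normc_real mulr1 ger0_norm. Qed.

Lemma normc_ge0 {R : realType} (z : R[i]) : 0 <= Normc.normc z.
Proof. by case: z => a b; exact: sqrtr_ge0. Qed.

Lemma normc_eq0 {R : realType} (z : R[i]) : (Normc.normc z == 0) = (z == 0).
Proof.
by apply/eqP/eqP => [/Normc.eq0_normc//|->]; exact: Normc.normc0.
Qed.

Lemma normc_gt0 {R : realType} (z : R[i]) : (0 < Normc.normc z) = (z != 0).
Proof. by rewrite lt0r normc_eq0 normc_ge0 andbT. Qed.

Lemma normc_sqr {R : realType} (a b : R) :
  Normc.normc (a +i* b) ^+ 2 = a ^+ 2 + b ^+ 2.
Proof. by rewrite /Normc.normc sqr_sqrtr// addr_ge0// sqr_ge0. Qed.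

Lemma normc_distC {R : realType} (z w : R[i]) :
  Normc.normc (z - w) = Normc.normc (w - z).
Proof. by rewrite -normcN opprB. Qed.

Lemma ler_normcB {R : realType} (z w : R[i]) :
  `|Normc.normc z - Normc.normc w| <= Normc.normc (z - w).
Proof.
have := le_normcD (z - w) w; have := le_normcD (w - z) z.
rewrite !subrK (normc_distC w z) ler_norml => h1 h2; apply/andP; split; lra.
Qed.

Lemma expiD {R : realType} (x y : R) : expi (x + y) = expi x * expi y.
Proof.
by rewrite /expi cosD sinD; simpc; rewrite (addrC (sin x * _)).
Qed.

Lemma expi2pi {R : realType} (x : R) : expi (x + pi *+ 2) = expi x.
Proof. by rewrite /expi cosD2pi sinD2pi. Qed.

Lemma polarP {R : realType} (z : R[i]) : z != 0 ->
  exists2 th, -pi < th <= pi & z = (Normc.normc z)%:C * expi th.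
Proof.
rewrite -normc_gt0; case: z => a b.
move: (normc_sqr a b); move: (Normc.normc (a +i* b)) => n n2 n0.
have h : (a / n) ^+ 2 + (b / n) ^+ 2 = 1.
  by rewrite !expr_div_n -mulrDl -n2 divff// expf_neq0// gt_eqF.
suff [th thpi [c s]] : exists2 th, -pi < th <= pi & cos th = a / n /\ sin th = b / n.
  exists th => //; rewrite /expi c s; simpc.
  by rewrite !(mulrC n) !divfK ?gt_eqF.
move: (a / n) (b / n) h => {n n0 n2} {}a {}b h.
have a1 : -1 <= a <= 1 by apply/andP; split; nra.
have pi0 := pi_gt0 R.
have sa : Num.sqrt (1 - a ^+ 2) = `|b| by rewrite -sqrtr_sqr -h; congr Num.sqrt; ring.
have := acos_lepi a1; have := acos_ge0 a1 => acos0 acospi.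
have [b0|b0] := leP 0 b.
  exists (acos a); first by apply/andP; split; lra.
  by rewrite acosK ?in_itv//= sin_acos// sa ger0_norm.
(* Here b < 0 forces a > -1, hence acos a < pi, and the angle avoids the excluded endpoint -pi. *)
exists (- acos a); last by rewrite cosN sinN acosK ?in_itv//= sin_acos// sa ltr0_norm// opprK.
have : acos a < pi by apply: acos_ltpi; apply/andP; split; nra.
by move=> ?; apply/andP; split; lra.
Qed.

(** * The kernel in polar coordinates and its measurability *)

Definition chord2 {R : realType} (r c : R) : R := 1 - 2 * r * c + r ^+ 2.

Lemma normc_chord {R : realType} (r th x : R) :
  Normc.normc (1 - r%:C * expi th * expi (- x)) ^+ 2 = chord2 r (cos (th - x)).
Proof.
rewrite -mulrA -expiD /expi; simpc; rewrite normc_sqr /chord2.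
have := cos2Dsin2 (th - x); move: (cos _) (sin _) => c s h.
have -> : (1 - r * c) ^+ 2 + (- (r * s)) ^+ 2 = 1 - 2 * r * c + r ^+ 2 * (c ^+ 2 + s ^+ 2) by ring.
by rewrite h mulr1.
Qed.

Lemma pkernel_chord {R : realType} (r th x : R) :
  pkernel (r%:C * expi th) x =
  if chord2 r (cos (th - x)) == 0 then +oo%E else ((chord2 r (cos (th - x)))^-1)%:E.
Proof. by rewrite -normc_chord /pkernel sqrf_eq0. Qed.

Lemma pkernel_ge0 {R : realType} (lam : R[i]) (x : R) : (0 <= pkernel lam x)%E.
Proof.
rewrite /pkernel; case: ifPn => // _.
by rewrite lee_fin invr_ge0 sqr_ge0.
Qed.

Lemma measurable_angles {R : realType} : measurable (@angles R).
Proof. exact: measurable_itv. Qed.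

Lemma measurable_pkernel {R : realType} (lam : R[i]) (D : set R) :
  measurable_fun D (pkernel lam).
Proof.
apply: (@measurable_funS _ _ _ _ setT) => //.
pose d (x : R) := Normc.normc (1 - lam * expi (- x)) ^+ 2.
have cd : continuous d.
  rewrite /d; case: (lam) => a b.
  have -> : (fun x : R => Normc.normc (1 - (a +i* b) * expi (- x)) ^+ 2) =
      (fun x : R => (1 - (a * cos x + b * sin x)) * (1 - (a * cos x + b * sin x)) +
        (a * sin x - b * cos x) * (a * sin x - b * cos x)).
    by apply/funext => x; rewrite /expi cosN sinN; simpc; rewrite normc_sqr; ring.
  have cs (x : R) : a * cos y + b * sin y @[y --> x] --> a * cos x + b * sin x.
    by apply: cvgD; apply: cvgMr => //; [exact: continuous_cos|exact: continuous_sin].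
  have sc (x : R) : a * sin y - b * cos y @[y --> x] --> a * sin x - b * cos x.
    by apply: cvgB; apply: cvgMr => //; [exact: continuous_sin|exact: continuous_cos].
  by move=> x; apply: cvgD; apply: cvgM; do ?[exact: sc|apply: cvgB; [exact: cvg_cst|exact: cs]].
rewrite (_ : pkernel lam = fun x => if d x == 0 then +oo%E else ((d x)^-1)%:E); last first.
  by apply/funext => x; rewrite /pkernel /d sqrf_eq0.
apply: measurable_fun_if => //.
- by apply: measurable_fun_eqr => //; exact: continuous_measurable_fun.
- rewrite setTI (_ : _ @^-1` _ = d @^-1` [set y | y != 0]); last first.
    by apply/seteqP; split => x /=; [move=> ->|move/negbTE].
  apply/measurable_EFinP; apply: open_continuous_measurable_fun.
    apply: open_comp => [x _|]; first exact: cd.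
    exact: open_neq.
  by move=> x; rewrite inE /= => dx; apply: cvgV => //; exact: cd.
Qed.

(** * Monotonicity of the radial weight and of the kernel *)

Lemma lt0_of_deriv {R : realType} (f f' : R -> R) :
  (forall x : R, 0 < x -> is_derive x 1 f (f' x)) ->
  (forall x : R, 0 < x < 1 -> 0 < f' x) -> f 1 = 0 ->
  forall x, 0 < x < 1 -> f x < 0.
Proof.
move=> df f'0 f1 x /andP[x0 x1]; rewrite -f1.
have dvf (y : R) : 0 < y -> derivable f y 1.
  by move=> y0; have [] := df y y0.
apply: (@gtr0_derive1_lt_oc R f 0 1) => //.
- by move=> y; rewrite in_itv /= => /andP[y0 _]; exact: dvf.
- move=> y; rewrite in_itv /= => y01; rewrite derive1E.
  have /andP[y0 _] := y01.
  by have [_ ->] := df y y0; exact: f'0.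
- by apply: derivable_within_continuous => y; rewrite in_itv /= => /andP[y0 _]; exact: dvf.
- by rewrite in_itv /= x0 ltW.
- by rewrite in_itv /= ltr01 lexx.
Qed.

(** With x = exp(-u) this is u < sinh u; the left side vanishes at 1 and has derivative (1 -
    1/x)^2. *)
Lemma ln_sinh_bound {R : realType} (x : R) : 0 < x < 1 -> x - x^-1 - 2 * ln x < 0.
Proof.
move=> x01; apply: (@lt0_of_deriv R (fun x => x - x^-1 - 2 * ln x) (fun x => (1 - x^-1) ^+ 2)) => //.
- move=> y y0; have dln := is_derive1_ln y0; have yn0 : y != 0 by rewrite gt_eqF.
  have dV := is_deriveV yn0 (is_derive_id y (1 : R)).
  apply: is_derive_eq; rewrite /GRing.scale /=; field; exact: yn0.
- move=> y /andP[y0 y1]; rewrite exprn_even_gt0 //= subr_eq0 eq_sym invr_eq1.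
  by rewrite lt_eqF.
- by rewrite invr1 ln1; ring.
Qed.

(** With x = exp(-u) this is tanh(u/2) < u/2; the left side vanishes at 1 and has derivative (1/x)
    ((1 - x)/(1 + x))^2. *)
Lemma ln_tanh_bound {R : realType} (x : R) : 0 < x < 1 -> ln x + 4 * (1 + x)^-1 - 2 < 0.
Proof.
move=> x01; apply: (@lt0_of_deriv R (fun x => ln x + 4 * (1 + x)^-1 - 2)
   (fun x => x^-1 * ((1 - x) / (1 + x)) ^+ 2)) => //.
- move=> y y0; have dln := is_derive1_ln y0; have yn0 : y != 0 by rewrite gt_eqF.
  have yn1 : 1 + y != 0 by rewrite gt_eqF// ltr_wpDl.
  have dD : is_derive y 1 (fun x => 1 + x) 1 by rewrite -[X in is_derive _ _ _ X]add0r; apply: is_deriveD.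
  have dV := is_deriveV yn1 dD.
  apply: is_derive_eq; rewrite /GRing.scale /=; field; by rewrite yn0 yn1.
- move=> y /andP[y0 y1]; rewrite mulr_gt0 ?invr_gt0// exprn_even_gt0//=.
  by rewrite mulf_eq0 negb_or subr_eq0 gt_eqF//= invr_eq0 gt_eqF// addr_gt0.
- by rewrite ln1; field.
Qed.

(* [pcoef] extended by its limit at [r = 1], so that one formula covers the
   unit circle too. *)
Definition wgt {R : realType} (r : R) : R := if r == 1 then 1 else pcoef r.

Lemma wgt_gt0 {R : realType} (r : R) : 0 < r -> 0 < wgt r.
Proof.
move=> r0; rewrite /wgt /pcoef; case: ifPn => // r1.
have [rl|rg|] := ltgtP r 1; last by move=> e; rewrite e eqxx in r1.
- have := @ln_lt0 R r; rewrite r0 rl => /(_ isT) h.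
  by rewrite mulr_gt0 ?divr_gt0 ?oppr_gt0//; nra.
- have h := @ln_gt0 R r rg; rewrite mulr_gt0 ?invr_gt0//.
  by rewrite invrN mulrN -mulNr opprB divr_gt0//; nra.
Qed.

Lemma wgtV {R : realType} (r : R) : 0 < r -> wgt r^-1 = wgt r / r ^+ 2.
Proof.
move=> r0; rewrite /wgt invr_eq1; case: ifPn => [/eqP ->|r1]; first by rewrite expr1n divr1.
have lr : ln r != 0 by rewrite ln_eq0.
rewrite /pcoef lnV ?posrE//; field.
by rewrite lr gt_eqF.
Qed.

(** From -ln r <= 1/r - 1 one gets wgt r >= r (1 + r)/2 >= r^2. This lets [pot_left_limit] work with
    the simpler weight r^2. *)
Lemma sqr_le_wgt {R : realType} (r : R) : 0 < r <= 1 -> r ^+ 2 <= wgt r.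
Proof.
move=> /andP[r0 r1]; rewrite /wgt; case: ifPn => [/eqP ->|rn1]; first by rewrite expr1n.
have {rn1}r1 : r < 1 by rewrite lt_neqAle rn1.
have l0 : ln r < 0 by rewrite ln_lt0// r0.
have : - ln r <= r^-1 - 1.
  rewrite -lnV ?posrE// -[X in ln X](subrKC 1) le_ln1Dx//.
  by rewrite ltrBrDl addrN invr_gt0.
rewrite -(ler_pM2l r0) mulrBr divff ?gt_eqF// mulr1 => h.
rewrite /pcoef mulrA ler_pdivlMr ?oppr_gt0//.
nra.
Qed.

(** With r = exp(-u) the quotient is tanh(u/2)/(2u), and tanh(v)/v decreases for v > 0. *)
Lemma wgt_incr {R : realType} (r s : R) : 0 < r -> r < s -> s <= 1 ->
  wgt r / (1 + r) ^+ 2 < wgt s / (1 + s) ^+ 2.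
Proof.
move=> r0 rs s1.
have tanh_bound (x : R) : 0 < x < 1 -> 2 * (1 - x) < - ln x * (1 + x).
  move=> /[dup] x01 /andP[x0 x1]; have := ln_tanh_bound _ x01.
  have x10 : 0 < 1 + x by lra.
  by rewrite -(ltr_pM2r x10) mul0r mulrBl mulrDl divfK ?gt_eqF//; lra.
have wgtE (x : R) : 0 < x < 1 -> wgt x / (1 + x) ^+ 2 = (1 - x) / (2 * (1 + x) * - ln x).
  move=> /[dup] x01 /andP[x0 x1]; rewrite /wgt lt_eqF// /pcoef.
  have l0 : ln x != 0 by rewrite lt_eqF// ln_lt0.
  by field; rewrite l0 gt_eqF ?ltr_wpDl.
have r01 : 0 < r < 1 by rewrite r0 (lt_le_trans rs).
have lr : 0 < - ln r by rewrite oppr_gt0 ln_lt0.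
rewrite wgtE// ltr_pdivrMr; last by rewrite !mulr_gt0// ltr_wpDl.
(* At s = 1 the quotient is 1/4, and [tanh_bound] at r alone suffices. *)
have [->|sn1] := eqVneq s 1.
  rewrite /wgt eqxx (_ : 1 / _ = 4^-1 :> R); last by field.
  by have := tanh_bound _ r01; nra.
have s01 : 0 < s < 1 by rewrite (lt_trans r0 rs) lt_neqAle sn1.
have /andP[s0 s1'] := s01.
have ls : 0 < - ln s by rewrite oppr_gt0 ln_lt0.
rewrite wgtE// mulrAC ltr_pdivlMr; last by rewrite !mulr_gt0// ltr_wpDl.
have rs01 : 0 < r / s < 1 by rewrite divr_gt0//= ltr_pdivrMr// mul1r.
have := tanh_bound _ rs01; rewrite ln_div ?posrE//.
rewrite -(ltr_pM2r s0) -!mulrA mulrBl mulrDl !mul1r divfK ?gt_eqF// => h1.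
have := ln_sinh_bound _ s01; rewrite -(ltr_pM2r s0) mul0r !mulrBl mulVf ?gt_eqF// => h2.
have h1' : 2 * (s - r) < (- ln r - - ln s) * (s + r).
  move: h1; rewrite (_ : (1 + r / s) * s = s + r); last by rewrite mulrDl mul1r divfK ?gt_eqF.
  by rewrite !opprB opprK addrC; lra.
(* After multiplication by s + r, the identity (1 - s)(1 + r) + 2(s - r) = (1 - r)(1 + s) splits the
   claim into [h1'], the tanh bound at r/s, and [h3], which follows from the sinh bound at s. *)
have {h1 h2 rs01} : (1 - r) * (1 + s) * - ln s < (1 - s) * (1 + r) * - ln r.
  have h3 : - ln s * (s + r) <= (1 + r) * (1 - s).
    have h4 : (1 + s) * (s + r) <= 2 * s * (1 + r) by nra.
    rewrite -(ler_pM2l (mulr_gt0 (ltr0Sn R 1) s0)); nra.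
  have sr0 : 0 < s + r by rewrite addr_gt0.
  rewrite -(ltr_pM2r sr0).
  have h5 : (1 - s) * (1 + r) * (- ln s * (s + r) + 2 * (s - r)) < (1 - s) * (1 + r) * (- ln r * (s + r)).
    by rewrite ltr_pM2l; [lra|nra].
  have h6 : 2 * (s - r) * (- ln s * (s + r)) <= 2 * (s - r) * ((1 + r) * (1 - s)).
    by rewrite ler_pM2l//; lra.
  lra.
lra.
Qed.

(** Division-free monotonicity of (1 + r)^2 / [chord2 r c] in r, valid also where the chord
    vanishes: the difference of the two sides is 2 (1 + c)(s - r)(1 - r s). *)
Lemma chord2_mono {R : realType} (r s c : R) :
  0 < r -> r <= s -> s <= 1 -> -1 <= c ->
  (1 + r) ^+ 2 * chord2 s c <= (1 + s) ^+ 2 * chord2 r c.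
Proof.
move=> r0 rs s1 c1; rewrite -subr_ge0 /chord2.
rewrite (_ : _ - _ = 2 * (1 + c) * ((s - r) * (1 - r * s))); last by ring.
by rewrite !mulr_ge0//; nra.
Qed.

Lemma chord2_ge {R : realType} (r c : R) : 0 <= r -> c <= 1 -> (1 - r) ^+ 2 <= chord2 r c.
Proof. by rewrite /chord2 => r0 c1; nra. Qed.

Lemma chord2_le {R : realType} (r c : R) : 0 <= r -> -1 <= c -> chord2 r c <= (1 + r) ^+ 2.
Proof. by rewrite /chord2 => r0 c1; nra. Qed.

Lemma chord2_gt0 {R : realType} (r c : R) : 0 <= r -> r != 1 -> c <= 1 -> 0 < chord2 r c.
Proof.
move=> r0 r1 c1; apply: lt_le_trans (chord2_ge _ _ r0 c1).
by rewrite exprn_even_gt0//= subr_eq0 eq_sym.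
Qed.

(** * The integral and the potential: bounds, inversion, radial monotonicity *)

Lemma Pint_ge0 {R : realType} (mu : probability R R) lam : (0 <= Pint mu lam)%E.
Proof. by apply: integral_ge0 => x _; exact: pkernel_ge0. Qed.

Lemma le_Pint {R : realType} (mu : probability R R) (a b : R) (lam lam' : R[i]) :
  0 <= a -> 0 <= b ->
  (forall x, a%:E * pkernel lam x <= b%:E * pkernel lam' x)%E ->
  (a%:E * Pint mu lam <= b%:E * Pint mu lam')%E.
Proof.
move=> a0 b0 h; have mA := @measurable_angles R.
have m l : measurable_fun (@angles R) (pkernel l) by exact: measurable_pkernel.
rewrite /Pint -!ge0_integralZl_EFin//; try by move=> x _; exact: pkernel_ge0.
apply: ge0_le_integral => //.
- by move=> x _; rewrite mule_ge0// ?lee_fin// pkernel_ge0.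
- exact: measurable_funeM.
- exact: measurable_funeM.
Qed.

Lemma integral_angles_cst {R : realType} (mu : probability R R) (a : R) :
  mu (@angles R) = 1%E -> (\int[mu]_(x in @angles R) a%:E = a%:E)%E.
Proof.
move=> h; rewrite -[LHS]/(\int[mu]_(x in @angles R) cst (a%:E) x)%E.
rewrite integral_cst; last exact: measurable_angles.
exact: (etrans (congr1 (fun z => a%:E * z)%E h) (mule1 _)).
Qed.

(* [1 / T], with value [+oo] allowed on the unit circle. *)
Definition pot {R : realType} (mu : probability R R) (lam : R[i]) : \bar R :=
  ((wgt (Normc.normc lam))%:E * Pint mu lam)%E.

Lemma TmuE {R : realType} (mu : probability R R) lam : Tmu mu lam = einv (pot mu lam).
Proof. by rewrite /Tmu /pot /wgt; case: ifPn => // _; rewrite mul1e. Qed.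

Section Potential.
Context {R : realType} (mu : probability R R) (hmu : mu (@angles R) = 1%E).

Lemma Pint_le (r th : R) : 0 <= r -> r != 1 ->
  (Pint mu (r%:C * expi th)%R <= ((1 - r) ^+ 2)^-1%:E)%E.
Proof.
move=> r0 r1; rewrite -[leRHS](integral_angles_cst mu _ hmu).
apply: ge0_le_integral => //; first exact: measurable_angles.
- by move=> x _; exact: pkernel_ge0.
- exact: measurable_pkernel.
- move=> x _; rewrite pkernel_chord.
  have c1 := cos_le1 (th - x).
  rewrite gt_eqF ?chord2_gt0// lee_fin lef_pV2 ?posrE ?chord2_gt0 ?chord2_ge//.
  by rewrite exprn_even_gt0//= subr_eq0 eq_sym.
Qed.

Lemma Pint_ge (r th : R) : 0 <= r ->
  (((1 + r) ^+ 2)^-1%:E <= Pint mu (r%:C * expi th)%R)%E.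
Proof.
move=> r0; rewrite -[leLHS](integral_angles_cst mu _ hmu).
apply: ge0_le_integral => //; first exact: measurable_angles.
- by move=> x _; rewrite lee_fin invr_ge0 sqr_ge0.
- exact: measurable_pkernel.
- move=> x _; rewrite pkernel_chord; case: ifPn => [_|c0]; first exact: leey.
  have c1 := cos_geN1 (th - x).
  have := chord2_ge r _ r0 (cos_le1 (th - x)) => h.
  have h0 := sqr_ge0 (1 - r).
  have h1 : 0 < chord2 r (cos (th - x)) by rewrite lt0r c0 (le_trans h0).
  have h2 : 0 < (1 + r) ^+ 2 by rewrite exprn_gt0// ltr_wpDr.
  by rewrite lee_fin lef_pV2 ?posrE ?chord2_le.
Qed.

Lemma pot_gt0 (lam : R[i]) : lam != 0 -> (0 < pot mu lam)%E.
Proof.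
move=> /[dup] l0; rewrite -normc_gt0 => n0; have [th _ E] := polarP lam l0.
apply: mule_gt0; first by rewrite lte_fin wgt_gt0.
rewrite E; apply: lt_le_trans (Pint_ge _ _ (ltW n0)).
by rewrite lte_fin invr_gt0 exprn_gt0// ltr_wpDr// ltW.
Qed.

Lemma pot_lty (r th : R) : 0 < r -> r != 1 -> (pot mu (r%:C * expi th)%R < +oo)%E.
Proof.
move=> r0 r1; apply: lte_mul_pinfty; rewrite ?lee_fin ?(ltW (wgt_gt0 _ _))//.
- by rewrite normc_polar ?wgt_gt0// ltW.
- exact: le_lt_trans (Pint_le _ _ (ltW r0) r1) (ltry _).
Qed.

(** Replacing r by 1/r divides both the weight and the squared chord by r^2, and the two factors
    cancel. *)
Lemma potV (r th : R) : 0 < r ->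
  pot mu (r^-1%:C * expi th)%R = pot mu (r%:C * expi th)%R.
Proof.
move=> r0; rewrite /pot !normc_polar ?invr_ge0 ?(ltW r0)//.
rewrite wgtV// EFinM -muleA; congr (_ * _)%E.
rewrite /Pint -ge0_integralZl_EFin ?invr_ge0 ?sqr_ge0//; last 3 first.
- exact: measurable_angles.
- by move=> x _; exact: pkernel_ge0.
- exact: measurable_pkernel.
apply: eq_integral => x _; rewrite !pkernel_chord.
have r20 : r ^+ 2 != 0 by rewrite expf_neq0// gt_eqF.
have -> : chord2 r^-1 (cos (th - x)) = chord2 r (cos (th - x)) / r ^+ 2.
  by rewrite /chord2; field; rewrite gt_eqF.
rewrite mulf_eq0 invr_eq0 (negbTE r20) orbF; case: ifPn => _.
  by rewrite gt0_muley// lte_fin invr_gt0 exprn_gt0.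
by rewrite -EFinM invf_div mulrA mulVf// mul1r.
Qed.

(** The strict gain sits in the factor wgt r / (1 + r)^2, which does not depend on x, so q is its
    ratio at s and r; the remaining factor is handled pointwise by [chord2_mono]. A multiplicative
    gap survives integration even if the right side is +oo. *)
Lemma pot_incr (r s th : R) : 0 < r -> r < s -> s <= 1 ->
  exists2 q, 1 < q & (q%:E * pot mu (r%:C * expi th)%R <= pot mu (s%:C * expi th)%R)%E.
Proof.
move=> r0 rs s1; have s0 := lt_trans r0 rs.
pose a (x : R) := wgt x / (1 + x) ^+ 2.
have a0 (x : R) : 0 < x -> 0 < a x.
  by move=> x0; rewrite divr_gt0 ?wgt_gt0// exprn_gt0// ltr_wpDl.
have wE (x : R) : 0 < x -> wgt x = a x * (1 + x) ^+ 2.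
  by move=> x0; rewrite divfK// expf_neq0// gt_eqF// ltr_wpDl.
exists (a s / a r).
  by rewrite ltr_pdivlMr ?a0// mul1r; exact: wgt_incr.
rewrite /pot !normc_polar ?(ltW s0) ?(ltW r0)// !muleA -EFinM.
rewrite (wE r)// mulrA divfK ?gt_eqF ?a0// (wE s)// !(EFinM (a s)) -!muleA.
apply: lee_wpmul2l; first by rewrite lee_fin; exact/ltW/a0.
apply: le_Pint; rewrite ?sqr_ge0// => x; rewrite !pkernel_chord.
have c1 := cos_le1 (th - x); have cN1 := cos_geN1 (th - x).
have cr : 0 < chord2 r (cos (th - x)).
  by apply: chord2_gt0 => //; [exact: ltW|rewrite lt_eqF// (lt_le_trans rs)].
rewrite gt_eqF//; case: ifPn => [_|cs].
  by rewrite gt0_muley ?leey// lte_fin exprn_gt0// ltr_wpDl.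
have {cs}cs : 0 < chord2 s (cos (th - x)).
  rewrite lt0r cs (le_trans _ (chord2_ge _ _ (ltW s0) c1))// sqr_ge0//.
rewrite -!EFinM lee_fin ler_pdivrMr// mulrAC ler_pdivlMr//.
by apply: chord2_mono => //; exact: ltW.
Qed.

Lemma pot_ltr (r s th : R) : 0 < r -> r < s -> s <= 1 ->
  (pot mu (r%:C * expi th)%R < pot mu (s%:C * expi th)%R)%E.
Proof.
move=> r0 rs s1; have [q q1] := pot_incr r s th r0 rs s1.
apply: lt_le_trans; rewrite -[ltLHS]mul1e lte_pmul2r ?lte_fin//.
  by rewrite ge0_fin_numE ?pot_lty ?lt_eqF ?(lt_le_trans rs)// ltW// pot_gt0// -normc_gt0 normc_polar// ltW.
by rewrite pot_gt0// -normc_gt0 normc_polar// ltW.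
Qed.

End Potential.

(** * Radial limits of the potential at 0 and at the circle *)

Section PotentialLimits.
Context {R : realType} (mu : probability R R) (hmu : mu (@angles R) = 1%E).

Lemma pot_small (a th : R) : 0 < a ->
  exists2 r : R, 0 < r < 1 & (pot mu (r%:C * expi th)%R < a%:E)%E.
Proof.
(* With r = exp(-x) the bound from [Pint_le] is (1 + r)/(2 x (1 - r)), at most 3/(2 x) because r <=
   1/2; and a x = 2 + a makes this less than a. *)
move=> a0; pose x := 2 / a + 1; pose r := expR (- x).
have x1 : 1 < x by rewrite ltrDr divr_gt0.
have r0 : 0 < r := expR_gt0 _.
have r2 : r <= 2^-1.
  rewrite /r expRN lef_pV2 ?posrE ?expR_gt0//.
  by apply: le_trans (expR_ge1Dx x); lra.
have r1 : r < 1 by lra.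
exists r; first by rewrite r0.
rewrite /pot normc_polar ?(ltW r0)//.
have w0 := wgt_gt0 r r0.
apply: (@le_lt_trans _ _ ((wgt r)%:E * ((1 - r) ^+ 2)^-1%:E)%E).
  apply: lee_wpmul2l; first by rewrite lee_fin ltW.
  by apply: Pint_le; rewrite ?(ltW r0)// lt_eqF.
rewrite -EFinM lte_fin ltr_pdivrMr; last by rewrite exprn_gt0// subr_gt0.
rewrite /wgt lt_eqF// /pcoef /r expRK opprK -/r mulrA ltr_pdivrMr; last by lra.
have : a * x = 2 + a by rewrite /x mulrDr mulrCA divff ?gt_eqF// !mulr1.
nra.
Qed.

Lemma pot_left_limit (a th : R) : (a%:E < pot mu (expi th))%E ->
  exists2 r : R, 0 < r < 1 & (a%:E < pot mu (r%:C * expi th)%R)%E.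
Proof.
rewrite {1}/pot normc_expi {1}/wgt eqxx mul1e => aP.
pose r (n : nat) : R := 1 - harmonic n / 2.
have h0 n : 0 < harmonic n :> R by exact: harmonic_gt0.
have h1 n : harmonic n <= 1 :> R by rewrite /harmonic /= invf_le1// ler1n.
have r0 n : 0 < r n by rewrite /r; have := h1 n; have := h0 n; lra.
have r1 n : r n < 1 by rewrite /r; have := h0 n; lra.
(* With weight r^2 the integrand increases with r for every x, so monotone convergence applies; it
   tends to the kernel on the circle because r^2 tends to 1. *)
pose g (n : nat) x := ((r n ^+ 2)%:E * pkernel ((r n)%:C * expi th)%R x)%E.
have gE n x : g n x = (r n ^+ 2 / chord2 (r n) (cos (th - x)))%:E.
  by rewrite /g pkernel_chord gt_eqF// chord2_gt0 ?cos_le1 ?(ltW (r0 _))// lt_eqF.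
have gmono x : {homo g^~ x : n m / (n <= m)%N >-> (n <= m)%E}.
  move=> n m nm; rewrite !gE lee_fin.
  have rnm : r n <= r m.
    by rewrite /r lerD2l lerN2 ler_pM2r ?invr_gt0// /harmonic /= lef_pV2 ?posrE// ler_nat.
  have c1 := cos_le1 (th - x).
  rewrite ler_pdivrMr ?chord2_gt0 ?(ltW (r0 _)) ?lt_eqF//.
  rewrite mulrAC ler_pdivlMr ?chord2_gt0 ?(ltW (r0 _)) ?lt_eqF//.
  move: (r0 n) (r1 n) (r0 m) (r1 m) rnm c1; rewrite /chord2.
  move: (r n) (r m) (cos _) => u v c u0 u1 v0 v1 uv c1; rewrite -subr_ge0.
  rewrite (_ : _ - _ = (v - u) * (v + u - 2 * (u * v) * c)); last by ring.
  rewrite mulr_ge0//; first lra.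
  have uvc : 0 <= u * v * (1 - c) by rewrite !mulr_ge0 ?subr_ge0 ?(ltW u0) ?(ltW v0).
  have uv' : 0 <= u * (1 - v) by apply: mulr_ge0; rewrite ?subr_ge0; exact: ltW.
  have vu' : 0 <= v * (1 - u) by apply: mulr_ge0; rewrite ?subr_ge0; exact: ltW.
  lra.
have rcvg : r n @[n --> \oo] --> (1 : R).
  rewrite -[X in _ --> X]subr0; apply: cvgB; first exact: cvg_cst.
  by rewrite -[X in _ --> X](mul0r 2^-1); apply: cvgMl => //; exact: cvg_harmonic.
have glim x : g n x @[n --> \oo] --> pkernel (expi th) x.
  rewrite -[expi th in X in _ --> X]mul1r -[1 in X in _ --> X]/(1%:C) pkernel_chord.
  case: ifPn => [/eqP|] c0.
    (* At the pole the limit is +oo: the chord of [r n] is 1/(2(n + 1)), and r n >= 1/2 gives g n x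
       >= (n + 1)^2 >= n + 1. *)
    have c1 : cos (th - x) = 1 by move: c0; rewrite /chord2 expr1n; lra.
    apply/cvgeyPge => A; near=> n; rewrite gE lee_fin.
    have -> : chord2 (r n) (cos (th - x)) = (harmonic n / 2) ^+ 2.
      by rewrite c1 /chord2 /r; ring.
    have n0 := h0 n; have n1 := h1 n.
    apply: (@le_trans _ _ n.+1%:R).
      by rewrite (@le_trans _ _ n%:R) ?ler_nat//; near: n; exact: nbhs_infty_ger.
    rewrite ler_pdivlMr; last by rewrite exprn_gt0// divr_gt0.
    rewrite expr_div_n expr2 mulrA mulrA mulfV ?pnatr_eq0// mul1r /r; nra.
  rewrite (_ : g^~ x = fun n => (r n ^+ 2 / chord2 (r n) (cos (th - x)))%:E); last exact/funext.
  apply: cvg_EFin; first by apply: nearW.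
  rewrite -[X in _ --> X]mul1r; apply: cvgM.
    by rewrite -[X in _ --> X](expr1n _ 2); apply: cvgM.
  apply: cvgV => //; rewrite /chord2; apply: cvgD.
    by apply: cvgB; [exact: cvg_cst|apply: cvgMl; apply: cvgMr].
  by apply: cvgM.
have /contrapT[n hn] : ~ ~ exists n, (a%:E < \int[mu]_(x in @angles R) g n x)%E.
  move/forallNP => H; move: aP; apply/negP; rewrite -leNgt.
  have -> : Pint mu (expi th) = limn (fun n => \int[mu]_(x in @angles R) g n x)%E.
    rewrite -monotone_convergence.
    - by apply: eq_integral => x _; apply/esym/cvg_lim => //; exact: glim.
    - exact: measurable_angles.
    - by move=> n; apply: measurable_funeM; exact: measurable_pkernel.
    - by move=> n x _; rewrite mule_ge0 ?lee_fin ?sqr_ge0// pkernel_ge0.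
    - by move=> x _ n m nm; exact: gmono.
  apply: lime_le; last by apply: nearW => n; rewrite leNgt; exact/negP.
  apply: ereal_nondecreasing_is_cvgn => n m nm; apply: ge0_le_integral => //.
  - exact: measurable_angles.
  - by move=> x _; rewrite mule_ge0 ?lee_fin ?sqr_ge0// pkernel_ge0.
  - by apply: measurable_funeM; exact: measurable_pkernel.
  - by apply: measurable_funeM; exact: measurable_pkernel.
  - by move=> x _; exact: gmono.
exists (r n); first by rewrite r0 r1.
apply: lt_le_trans hn _.
rewrite /pot normc_polar ?(ltW (r0 _))// ge0_integralZl_EFin ?sqr_ge0//.
- apply: lee_wpmul2r; first exact: Pint_ge0.
  by rewrite lee_fin sqr_le_wgt// r0 ltW.
- exact: measurable_angles.
- by move=> x _; exact: pkernel_ge0.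
- exact: measurable_pkernel.
Unshelve. all: by end_near. Qed.

End PotentialLimits.

(** * Continuity of the potential off the unit circle *)

Section PotentialContinuity.
Context {R : realType} (mu : probability R R) (hmu : mu (@angles R) = 1%E).

(** For every x, |1 - lam e^(-ix)| is at least the distance of lam to the circle. A move of at most
    e times that distance therefore enlarges the denominator by a factor at most 1 + e, uniformly in
    x. *)
Lemma Pint_cmp (lam lam' : R[i]) (e : R) : 0 <= e -> Normc.normc lam != 1 ->
  Normc.normc (lam - lam') <= e * `|1 - Normc.normc lam| ->
  (Pint mu lam <= ((1 + e) ^+ 2)%:E * Pint mu lam')%E.
Proof.
move=> e0 l1 h; rewrite -[leLHS]mul1e; apply: le_Pint; rewrite ?sqr_ge0// => x.
rewrite mul1e /pkernel.
set d := Normc.normc (1 - lam * _); set d' := Normc.normc (1 - lam' * _).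
have gd : `|1 - Normc.normc lam| <= d.
  have := ler_normcB 1 (lam * expi (- x)).
  by rewrite Normc.normcM normc_expi mulr1 Normc.normc1.
have d0 : 0 < d by apply: lt_le_trans gd; rewrite normr_gt0 subr_eq0 eq_sym.
have dd' : d' <= (1 + e) * d.
  have -> : d' = Normc.normc ((1 - lam * expi (- x)) + (lam - lam') * expi (- x)).
    by congr Normc.normc; ring.
  apply: le_trans (le_normcD _ _) _.
  rewrite -/d Normc.normcM normc_expi mulr1 mulrDl mul1r lerD2l.
  by apply: le_trans h _; rewrite ler_wpM2l.
rewrite (gt_eqF d0); case: ifPn => [_|d'0].
  by rewrite gt0_muley ?leey// lte_fin exprn_gt0// ltr_wpDr.
have {}d'0 : 0 < d' by rewrite lt0r d'0 normc_ge0.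
rewrite -EFinM lee_fin -[leLHS]mul1r ler_pdivrMr ?exprn_gt0// mulrAC.
rewrite ler_pdivlMr ?exprn_gt0// mul1r -exprMn ler_pXn2r// nnegrE ?ltW//.
by rewrite mulr_gt0// ltr_wpDr.
Qed.

Lemma cvg_wgt (r : R) : 0 < r -> r != 1 -> wgt x @[x --> r] --> wgt r.
Proof.
move=> r0 r1.
have l0 : ln r != 0 by rewrite ln_eq0.
have H : pcoef x @[x --> r] --> pcoef r.
  apply: cvgMr; apply: cvgM.
    by apply: cvgB; [exact: cvg_cst|apply: cvgM; exact: cvg_id].
  by apply: cvgV; [rewrite oppr_eq0|apply: cvgN; exact: continuous_ln].
rewrite {2}/wgt (negbTE r1); apply: cvg_trans H; apply: near_eq_cvg.
near=> x; rewrite /wgt ifN//.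
near: x; apply: (@open_nbhs_nbhs R r [set y | y != 1]); split => //; exact: open_neq.
Unshelve. all: by end_near. Qed.

Lemma pot_near (lam0 : R[i]) (q : R) : lam0 != 0 -> Normc.normc lam0 != 1 -> 1 < q ->
  exists2 d, 0 < d & forall lam, Normc.normc (lam - lam0) < d ->
    (pot mu lam <= q%:E * pot mu lam0)%E /\ (pot mu lam0 <= q%:E * pot mu lam)%E.
Proof.
rewrite -normc_gt0; set n0 := Normc.normc lam0 => n00 n01 q1.
(* For e <= 1, (1 + e)^3 <= 1 + 7 e. One factor 1 + e is spent on the weight and two on the
   kernels. *)
pose e := Num.min 1 ((q - 1) / 7).
have e0 : 0 < e by rewrite lt_min ltr01 divr_gt0// subr_gt0.
have e1 : e <= 1 by rewrite ge_min lexx.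
have eq : (1 + e) ^+ 2 * (1 + e) <= q.
  have : e <= (q - 1) / 7 by rewrite ge_min lexx orbT.
  nra.
have w0 := wgt_gt0 _ n00.
have g0 : 0 < `|1 - n0| by rewrite normr_gt0 subr_eq0 eq_sym.
have : \forall x \near n0, [/\ 0 < x, wgt x < (1 + e) * wgt n0 & wgt n0 / (1 + e) < wgt x].
  near=> x; split; near: x.
  - exact: lt_nbhsr.
  - by apply: (cvgr_lt _ (cvg_wgt _ n00 n01)); rewrite ltr_pMl// ltrDl.
  - by apply: (cvgr_gt _ (cvg_wgt _ n00 n01)); rewrite ltr_pdivrMr ?ltr_pMr ?ltrDl// addr_gt0.
case/nbhs_normP => d1 /= d10 H.
(* The second bound keeps lam at least half as far from the circle as lam0, so that [Pint_cmp]
   applies with the same e in both directions. *)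
exists (Num.min d1 (e / 2 * `|1 - n0|)).
  by rewrite lt_min d10 mulr_gt0// divr_gt0.
move=> lam; rewrite lt_min => /andP[l1 l2].
have /H /= [n1 wl wg] : ball_ Num.norm n0 d1 (Normc.normc lam).
  by rewrite /ball_ /=; apply: le_lt_trans (ler_normcB _ _) _; rewrite normc_distC.
have g1 : `|1 - n0| / 2 <= `|1 - Normc.normc lam|.
  have := ler_normcB lam lam0; have := ler_distD (Normc.normc lam) 1 n0.
  rewrite -/n0; move: l2; nra.
have l1' : Normc.normc lam != 1.
  have : 0 < `|1 - Normc.normc lam| by apply: lt_le_trans g1; rewrite divr_gt0.
  by rewrite normr_gt0 subr_eq0 eq_sym.
have qw (u v : R) (A B : \bar R) : (0 <= B)%E -> 0 <= u -> 0 <= v -> u <= (1 + e) * v ->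
    (A <= ((1 + e) ^+ 2)%:E * B -> u%:E * A <= q%:E * (v%:E * B))%E.
  move=> B0 u0 v0 uv AB; apply: (@le_trans _ _ (u%:E * (((1 + e) ^+ 2)%:E * B))%E).
    by apply: lee_wpmul2l => //; rewrite lee_fin.
  rewrite !muleA -!EFinM; apply: lee_wpmul2r => //; rewrite lee_fin.
  have : u * (1 + e) ^+ 2 <= (1 + e) * v * (1 + e) ^+ 2 by rewrite ler_wpM2r// sqr_ge0.
  have : v * ((1 + e) ^+ 2 * (1 + e)) <= v * q by rewrite ler_wpM2l.
  lra.
split.
- apply: qw; rewrite ?Pint_ge0// ?(ltW (wgt_gt0 _ _))// ?(ltW wl)//.
  apply: Pint_cmp; rewrite ?(ltW e0)//.
  by apply: le_trans (ltW l2) _; rewrite -mulrA ler_pM2l// mulrC.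
- apply: qw; rewrite ?Pint_ge0// ?(ltW (wgt_gt0 _ _))//.
    by move: wg; rewrite ltr_pdivrMr ?addr_gt0// mulrC => /ltW.
  apply: Pint_cmp; rewrite ?(ltW e0)// -/n0 normc_distC.
  apply: le_trans (ltW l2) _; rewrite ler_wpM2r//; lra.
Unshelve. all: by end_near. Qed.

Lemma pot_fin (lam : R[i]) : lam != 0 -> Normc.normc lam != 1 ->
  exists2 p, 0 < p & pot mu lam = p%:E.
Proof.
move=> l0 l1; have [th _ E] := polarP _ l0.
have : (pot mu lam < +oo)%E by rewrite E; apply: pot_lty; rewrite ?normc_gt0.
have := pot_gt0 mu hmu _ l0.
by case: (pot mu lam) => // p p0 _; exists p.
Qed.

Lemma pot_gt_near (lam0 : R[i]) (a : R) : lam0 != 0 -> Normc.normc lam0 != 1 -> 0 < a ->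
  (a%:E < pot mu lam0)%E ->
  exists2 d, 0 < d & forall lam, Normc.normc (lam - lam0) < d -> (a%:E < pot mu lam)%E.
Proof.
move=> l0 l1 a0; have [p p0 pE] := pot_fin _ l0 l1; rewrite pE lte_fin => ap.
(* The midpoint q of 1 and p/a satisfies q a < p, so a value at most a near [lam0] would contradict
   p <= q * [pot mu lam]. *)
have q1 : 1 < (1 + p / a) / 2.
  have : 1 < p / a by rewrite ltr_pdivlMr// mul1r.
  lra.
have qap : (1 + p / a) / 2 * a < p by rewrite mulrAC mulrDl mul1r divfK ?gt_eqF//; lra.
have [d d0 H] := pot_near _ _ l0 l1 q1; exists d => // lam /H[_]; rewrite pE.
apply: contraPT; rewrite -leNgt => h; apply/negP; rewrite -ltNge.
apply: (@le_lt_trans _ _ (((1 + p / a) / 2)%:E * a%:E)%E); last by rewrite -EFinM lte_fin.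
by apply: lee_wpmul2l => //; rewrite lee_fin; lra.
Qed.

Lemma pot_lt_near (lam0 : R[i]) (a : R) : lam0 != 0 -> Normc.normc lam0 != 1 -> 0 < a ->
  (pot mu lam0 < a%:E)%E ->
  exists2 d, 0 < d & forall lam, Normc.normc (lam - lam0) < d -> (pot mu lam < a%:E)%E.
Proof.
move=> l0 l1 a0; have [p p0 pE] := pot_fin _ l0 l1; rewrite pE lte_fin => pa.
have q1 : 1 < (1 + a / p) / 2.
  have : 1 < a / p by rewrite ltr_pdivlMr// mul1r.
  lra.
have qap : (1 + a / p) / 2 * p < a by rewrite mulrAC mulrDl mul1r divfK ?gt_eqF//; lra.
have [d d0 H] := pot_near _ _ l0 l1 q1; exists d => // lam /H[+ _]; rewrite pE.
by move=> h; apply: le_lt_trans h _; rewrite -EFinM lte_fin.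
Qed.

Lemma polar_neq0 (r th : R) : 0 < r -> r%:C * expi th != 0.
Proof. by move=> r0; rewrite -normc_gt0 normc_polar// ltW. Qed.

Lemma normc_polarB (r s th : R) :
  Normc.normc (r%:C * expi th - s%:C * expi th) = `|r - s|.
Proof. by rewrite -mulrBl Normc.normcM normc_expi mulr1 -rmorphB normc_real. Qed.

(** Inside the disk this is continuity; at r = 1, where the potential may be infinite or
    discontinuous, it is the monotone limit along the radius. *)
Lemma pot_left (a r th : R) : 0 < a -> 0 < r <= 1 ->
  (a%:E < pot mu (r%:C * expi th)%R)%E ->
  exists2 s, 0 < s < r & (a%:E < pot mu (s%:C * expi th)%R)%E.
Proof.
move=> a0 /andP[r0]; rewrite le_eqVlt => /orP[/eqP ->|r1].
  by rewrite mul1r => /pot_left_limit; apply.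
move=> ap; have [d d0 H] := pot_gt_near _ _ (polar_neq0 _ th r0) ltac:(by rewrite normc_polar ?(ltW r0)// lt_eqF) a0 ap.
pose s := Num.max (r / 2) (r - d / 2).
have sr : s < r by rewrite gt_max; apply/andP; split; lra.
exists s; first by rewrite sr andbT lt_max divr_gt0.
apply: H; rewrite normc_polarB ltr_norml; apply/andP; split; last lra.
have : r - d / 2 <= s by rewrite le_max lexx orbT.
lra.
Qed.

End PotentialContinuity.

(** * The region as a superlevel set of the potential, and its symmetry *)

Section Region.
Context {R : realType} (mu : probability R R) (hmu : mu (@angles R) = 1%E).
Context (t : R) (ht : 0 < t).

Lemma f1muE (th : R) : f1mu mu th = pot mu (1%:C * expi th)%R.
Proof. by rewrite /pot normc_polar ?ler01// /wgt eqxx mul1e mul1r. Qed.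

Lemma fmuE (r th : R) : 0 < r < 1 -> fmu mu r th = pot mu (r%:C * expi th)%R.
Proof.
by move=> /andP[r0 r1]; rewrite /pot normc_polar ?(ltW r0)// /wgt lt_eqF.
Qed.

Let low (th : R) : set R := [set r : R | 0 < r < 1 /\ (fmu mu r th < (t^-1)%:E)%E].

Let low_ub (th : R) : has_ubound (low th).
Proof. by exists 1 => r [/andP[_ /ltW]]. Qed.

Lemma rt_gt0 (th : R) : 0 < rt mu t th.
Proof.
have t0 : 0 < t^-1 by rewrite invr_gt0.
have [r r01 h] := pot_small mu hmu _ th t0.
have /andP[r0 _] := r01; apply: lt_le_trans r0 _.
by apply: (ub_le_sup (low_ub th)); split => //; rewrite fmuE.
Qed.

(** Strictness needs [pot_left]: a radius s < r where the potential still exceeds 1/t is, by radial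
    monotonicity, an upper bound of the set defining [rt]. *)
Lemma rt_lt (r th : R) : 0 < r <= 1 ->
  ((t^-1)%:E < pot mu (r%:C * expi th)%R)%E -> rt mu t th < r.
Proof.
move=> r01 h; have t0 : 0 < t^-1 by rewrite invr_gt0.
have [s /andP[s0 sr] hs] := pot_left mu hmu _ _ _ t0 r01 h.
apply: le_lt_trans sr; apply: (@ge_sup _ (low th)).
  have [u u01 hu] := pot_small mu hmu _ th t0.
  by exists u; split => //; rewrite fmuE.
move=> u [u01]; rewrite fmuE// => hu; rewrite leNgt; apply/negP => su.
have /andP[_ u1] := u01.
have := pot_ltr mu hmu _ _ th s0 su (ltW u1).
by rewrite ltNge (ltW (lt_trans hu hs)).
Qed.

Lemma lt_pot_rt (r th : R) : rt mu t th < r -> r < 1 ->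
  ((t^-1)%:E < pot mu (r%:C * expi th)%R)%E.
Proof.
move=> rtr r1; have rt0 := rt_gt0 th.
(* The midpoint lies above the supremum, so the potential there is at least 1/t; strict monotonicity
   from s to r then gives a strict inequality. *)
pose s := (rt mu t th + r) / 2.
have s0 : 0 < s by rewrite /s; lra.
have sr : s < r by rewrite /s; lra.
have s01 : 0 < s < 1 by rewrite s0 (lt_trans sr).
apply: le_lt_trans (pot_ltr mu hmu _ _ th s0 sr (ltW r1)).
rewrite leNgt; apply/negP => h.
have : s <= rt mu t th by apply: (ub_le_sup (low_ub th)); split => //; rewrite fmuE.
by rewrite /s; lra.
Qed.

Lemma DeltaE : Delta mu t = [set lam | lam != 0 /\ ((t^-1)%:E < pot mu lam)%E].
Proof.
apply/seteqP; split => [lam [th [r [[thpi hU] [/andP[rtr rrt] ->]]]]|lam [l0 h]] /=.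
  have rt0 := rt_gt0 th; have r0 := lt_trans rt0 rtr.
  split; first exact: polar_neq0.
  have [r1|r1|->] := ltgtP r 1; last by rewrite -f1muE.
    exact: lt_pot_rt.
  rewrite -potV//; apply: lt_pot_rt; last by rewrite invf_lt1.
  by rewrite -[X in X < _]invrK ltf_pV2 ?posrE ?invr_gt0.
have [th thpi E] := polarP _ l0; move: h; rewrite E.
rewrite -normc_gt0 in l0; move: (Normc.normc lam) l0 => {lam E} r r0 h.
have rt0 := rt_gt0 th.
(* Monotonicity carries the bound out to radius 1, which puts th in [Ut]. Radii above 1 are treated
   through their inverses. *)
have near1 (s : R) : 0 < s <= 1 -> ((t^-1)%:E < pot mu (s%:C * expi th)%R)%E ->
    Ut mu t th /\ rt mu t th < 1.
  move=> /andP[s0 s1] hs; have h1 : ((t^-1)%:E < pot mu (1%:C * expi th)%R)%E.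
    apply: lt_le_trans hs _; move: s1; rewrite le_eqVlt => /orP[/eqP -> //|s1].
    exact/ltW/pot_ltr.
  by split; [split; rewrite ?f1muE|apply: rt_lt; rewrite ?ltr01 ?lexx].
exists th, r; have [r1|r1] := ltP 1 r.
  have hV := h; rewrite -potV// in hV.
  have rV : 0 < r^-1 <= 1 by rewrite invr_gt0 r0 invf_le1// ltW.
  have [U rt1] := near1 _ rV hV; split => //; split => //.
  rewrite (lt_trans rt1 r1)/= -[ltLHS]invrK ltf_pV2 ?posrE ?invr_gt0//.
  exact: rt_lt.
have r01 : 0 < r <= 1 by rewrite r0.
have [U rt1] := near1 _ r01 h; split => //; split => //.
by rewrite rt_lt//= (le_lt_trans r1)// -[ltLHS]invr1 ltf_pV2 ?posrE.
Qed.

(** The map sends r e^(i th) to r^-1 e^(i th), which preserves each ray segment. Being an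
    involution, it maps the region onto itself as soon as it maps it into itself. *)
Lemma Delta_conjV : (fun lam : R[i] => (lam^*)^-1) @` Delta mu t = Delta mu t.
Proof.
have conjV (r th : R) : 0 < r -> ((r%:C * expi th)^*)^-1 = r^-1%:C * expi th.
  move=> r0; have rC : r%:C != 0 by rewrite -normc_eq0 normc_real normr_eq0 gt_eqF.
  apply: (@mulfI _ (r%:C * expi th)^*).
    by rewrite conjc_eq0 polar_neq0.
  rewrite mulfV ?conjc_eq0 ?polar_neq0// /expi; simpc.
  have := cos2Dsin2 th; move: (cos th) (sin th) => c s h.
  by congr (_ +i* _); [rewrite -h; field|field]; rewrite gt_eqF.
have sub lam : Delta mu t lam -> Delta mu t ((lam^*)^-1).
  move=> [th [r [U [/andP[rtr rrt] ->]]]]; have rt0 := rt_gt0 th.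
  have r0 := lt_trans rt0 rtr.
  exists th, r^-1; rewrite conjV//; split => //; split => //.
  by rewrite ltf_pV2 ?posrE// rtr andbT -[ltLHS]invrK ltf_pV2 ?posrE ?invr_gt0.
apply/seteqP; split => [_ [lam h <-]|lam h]; first exact: sub.
exists ((lam^*)^-1); first exact: sub.
by rewrite /= fmorphV invrK; exact: conjcK.
Qed.

End Region.

(** * Arcs of the circle on which f(1^-, .) is bounded *)

Lemma two_sub_2cos_le {R : realType} (y : R) : 2 - 2 * cos y <= y ^+ 2.
Proof.
wlog y0 : y / 0 <= y => [H|].
  have [/H//|/ltW y0] := leP 0 y.
  by rewrite -cosN -sqrrN; apply: H; rewrite oppr_ge0.
have [->|yn0] := eqVneq y 0; first by rewrite cos0 expr0n /=; lra.
have h0 : 0 < y / 2 by rewrite divr_gt0// lt0r yn0.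
(* The left side is 4 sin(y/2)^2, and the mean value theorem writes sin(y/2) as cos(c) y/2. *)
have [|c _] := @MVT R sin cos 0 (y / 2) h0 (fun x _ => is_derive_sin x).
- by apply: continuous_subspaceT => x; exact: continuous_sin.
rewrite sin0 !subr0 => sE.
have -> : cos y = 1 - 2 * sin (y / 2) ^+ 2.
  rewrite {1}(splitr y) cosD; have := cos2Dsin2 (y / 2).
  rewrite -!expr2; lra.
have c1 : cos c ^+ 2 <= 1 by have := cos2Dsin2 c; have := sqr_ge0 (sin c); lra.
have := ler_wpM2r (sqr_ge0 y) c1.
by rewrite sE exprMn expr_div_n; lra.
Qed.

Section Arcs.
Context {R : realType} (mu : probability R R).

Lemma f1mu2pi (th : R) : f1mu mu (th + pi *+ 2) = f1mu mu th.
Proof. by rewrite /f1mu expi2pi. Qed.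

Lemma measurable_arc (a b : R) : measurable (`[a, b]%classic `&` @angles R).
Proof. by apply: measurableI; exact: measurable_itv. Qed.

(** A Chebyshev estimate: on the arc the kernel based at the endpoint a is at least 1/(b - a)^2,
    since a chord is no longer than its arc. *)
Lemma arc_mass_le (a b M : R) : a < b -> 0 <= M -> (f1mu mu a <= M%:E)%E ->
  (mu (`[a, b]%classic `&` @angles R) <= (M * (b - a) ^+ 2)%:E)%E.
Proof.
move=> ab M0 h; have ba0 : 0 < (b - a) ^+ 2 by rewrite exprn_gt0// subr_gt0.
rewrite EFinM muleC -lee_pdivrMl//; apply: le_trans h.
rewrite -integral_cst; last exact: measurable_arc.
apply: (@le_trans _ _ (\int[mu]_(x in `[a, b] `&` @angles R) pkernel (expi a) x)%E).
  apply: ge0_le_integral => //.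
  - exact: measurable_arc.
  - by move=> x _; rewrite lee_fin invr_ge0 ltW.
  - exact: measurable_pkernel.
  - move=> x [/=]; rewrite in_itv /= => /andP[ax xb] _.
    rewrite -[expi a]mul1r -[1]/(1%:C) pkernel_chord.
    have le : chord2 1 (cos (a - x)) <= (b - a) ^+ 2.
      have := two_sub_2cos_le (a - x); rewrite /chord2 expr1n; nra.
    case: ifPn => [_|c0]; first exact: leey.
    rewrite lee_fin lef_pV2 ?posrE// lt0r c0.
    by have := cos_le1 (a - x); rewrite /chord2 expr1n; lra.
rewrite /f1mu /Pint; apply: ge0_subset_integral => //.
- exact: measurable_arc.
- exact: measurable_angles.
- exact: measurable_pkernel.
- by move=> x _; exact: pkernel_ge0.
Qed.

(* An arc of length [l] has mass at most [M l ^ 2]; cutting it into [2 ^ n]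
   equal arcs gains a factor [2 ^ n]. *)
Lemma arc_mass_le_exp (M : R) (n : nat) (a b : R) : 0 <= M -> a < b ->
  (forall th, a <= th <= b -> (f1mu mu th <= M%:E)%E) ->
  (mu (`[a, b]%classic `&` @angles R) <= (M * (b - a) ^+ 2 / 2 ^+ n)%:E)%E.
Proof.
move=> M0; elim: n a b => [|n IH] a b ab h.
  by rewrite expr0 divr1; apply: arc_mass_le => //; apply: h; rewrite lexx ltW.
pose m := (a + b) / 2.
have am : a < m by rewrite /m; lra.
have mb : m < b by rewrite /m; lra.
have h1 := IH a m am _; have h2 := IH m b mb _.
apply: (@le_trans _ _ (mu (`[a, m]%classic `&` @angles R) + mu (`[m, b]%classic `&` @angles R))%E).
  apply: le_trans (measureU2 _ _ _); try exact: measurable_arc.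
  apply: le_measure; rewrite ?inE; [exact: measurable_arc|apply: measurableU; exact: measurable_arc|].
  move=> x [/=]; rewrite !in_itv /= => /andP[ax xb] Ax.
  by have [xm|/ltW xm] := leP x m; [left|right]; split => //=; rewrite ?in_itv /= ?ax ?xm ?xb.
apply: le_trans (leeD (h1 _) (h2 _)) _.
- by move=> th /andP[x1 x2]; apply: h; rewrite x1 (le_trans x2)// ltW.
- by move=> th /andP[x1 x2]; apply: h; rewrite x2 andbT (le_trans _ x1)// ltW.
have e : 2 ^+ n != 0 :> R by rewrite expf_neq0// pnatr_eq0.
rewrite -EFinD lee_fin (exprS _ n) /m le_eqVlt; apply/orP; left; apply/eqP.
by move: (2 ^+ n) e => E e; field.
Qed.

Lemma arc_mass0 (M a b : R) : 0 <= M -> a < b ->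
  (forall th, a <= th <= b -> (f1mu mu th <= M%:E)%E) ->
  mu (`[a, b]%classic `&` @angles R) = 0%E.
Proof.
move=> M0 ab h; apply/eqP; rewrite eq_le measure_ge0 andbT.
apply/lee_addgt0Pr => e e0; rewrite add0e.
pose C := M * (b - a) ^+ 2; have C0 : 0 <= C by rewrite mulr_ge0// sqr_ge0.
(* This makes C/e < n < 2^n, so the bound C/2^n drops below e. *)
pose n := (Num.truncn (C / e)).+1.
apply: le_trans (arc_mass_le_exp M n a b M0 ab h) _.
rewrite lee_fin -/C ler_pdivrMr ?exprn_gt0// mulrC -ler_pdivrMr//.
apply: (@le_trans _ _ n%:R).
  by apply/ltW; rewrite /n truncnS_gt.
by rewrite -natrX ler_nat ltnW// ltn_expl.
Qed.

Lemma cos_lt_of_far (d y : R) : 0 < d < pi -> `|y| < pi *+ 2 ->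
  d < `|y| -> `|y| < pi *+ 2 - d -> cos y < cos d.
Proof.
move=> /andP[d0 dpi] y2 dy yd; rewrite -cos_norm.
have [yp|yp] := leP `|y| pi.
  by rewrite ltr_cos// in_itv /= ?normr_ge0 ?yp// ?ltW//.
rewrite -cosN -cosD2pi ltr_cos ?in_itv//=; rewrite ?(ltW d0) ?(ltW dpi)//; move: y2 dy yd yp; rewrite mulr2n; lra.
Qed.

(** Put y = th - x, c = cos y and C = cos d. The two outer squared chords have product 4 (C - c)^2
    and sum 4 (1 - c C), so the right side is (1 - c C)/(C - c)^2, while the two central kernels add
    up to 1/(1 - c). The claim follows from 1 - c C >= C - c and, as C - c <= 2, from 1 - c >= (1 +
    (1 - C)/2)(C - c). *)
Lemma pkernel_convex (th d x : R) : 0 < d < pi -> cos (th - x) < cos d ->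
  ((1 + (1 - cos d) / 2)%:E * (pkernel (expi th) x + pkernel (expi th) x) <=
    pkernel (expi (th + d)) x + pkernel (expi (th - d)) x)%E.
Proof.
move=> dpi cd.
have e1 (u : R) : expi u = 1%:C * expi u by rewrite mul1r.
rewrite (e1 th) (e1 (th + d)) (e1 (th - d)) !pkernel_chord.
rewrite (addrAC th d) (addrAC th (- d)).
move: (th - x) cd => y cd; rewrite cosD cosB.
have := cos2Dsin2 y; have := cos2Dsin2 d.
have cN1 := cos_geN1 y; have d1 := cos_le1 d.
move: (cos y) (sin y) (cos d) (sin d) cd cN1 d1 => c s C S cC cN1 C1 hC hc.
rewrite /chord2 !expr1n.
set u := 1 - _ + 1; set v := 1 - _ + 1; set w := 1 - _ + 1.
have uE : u = 2 * (1 - c) by rewrite /u; ring.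
have vw : v * w = 4 * (C - c) ^+ 2.
  have S2 : S ^+ 2 = 1 - C ^+ 2 by rewrite -hC; ring.
  have s2 : s ^+ 2 = 1 - c ^+ 2 by rewrite -hc; ring.
  rewrite (_ : v * w = 4 * ((1 - c * C) ^+ 2 - s ^+ 2 * S ^+ 2)); last by rewrite /v /w; ring.
  by rewrite S2 s2; ring.
have vDw : v + w = 4 * (1 - c * C) by rewrite /v /w; ring.
have vwn0 : v * w != 0 by rewrite vw mulf_neq0 ?pnatr_eq0// expf_neq0// gt_eqF// subr_gt0.
have := vwn0; rewrite mulf_eq0 negb_or => /andP[v0 w0].
have u0 : 0 < u by rewrite uE; lra.
rewrite (negbTE v0) (negbTE w0) (gt_eqF u0) -!EFinD -EFinM lee_fin.
rewrite (_ : v^-1 + w^-1 = (v + w) / (v * w)); last by field; rewrite v0 w0.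
rewrite vDw vw uE.
have cc : 0 < C - c by lra.
have c1 : 0 < 1 - c by lra.
rewrite ler_pdivlMr ?mulr_gt0 ?exprn_gt0//.
rewrite (_ : (2 * (1 - c))^-1 + (2 * (1 - c))^-1 = (1 - c)^-1); last by field; rewrite gt_eqF.
rewrite mulrAC ler_pdivrMr//.
have k1 : C - c <= 1 - c * C by nra.
have k2 : (1 + (1 - C) / 2) * (C - c) <= 1 - c by nra.
have k3 : (C - c) * ((1 + (1 - C) / 2) * (C - c)) <= (1 - c * C) * (1 - c).
  by apply: ler_pM => //; [lra|rewrite mulr_ge0//; lra].
lra.
Qed.

End Arcs.

Lemma f1mu_no_local_max {R : realType} (mu : probability R R) (th d M : R) :
  -pi < th <= pi -> 0 < d < pi -> 0 < M -> f1mu mu th = M%:E ->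
  exists2 th', `|th' - th| <= d & (M%:E < f1mu mu th')%E.
Proof.
move=> /andP[th1 th2] dpi M0 fth; have /andP[d0 dpi'] := dpi.
have pi0 := pi_gt0 R.
apply: contrapT => /forall2NP H.
have {}H th' : `|th' - th| <= d -> (f1mu mu th' <= M%:E)%E.
  by move=> h; have [//|] := H th'; rewrite leNgt => /negP.
(* The arc around [th] may cross the cut at [pi], hence the three translates. *)
pose I (s : R) : set R := `[th + s - d, th + s + d]%classic `&` @angles R.
have I0 (s : R) : (forall u, f1mu mu (u + s) = f1mu mu u) -> mu (I s) = 0%E.
  move=> per; apply: (arc_mass0 mu M); rewrite ?(ltW M0)//; first lra.
  move=> u /andP[u1 u2]; rewrite -[u](subrK s) per; apply: H.
  by rewrite ler_norml; apply/andP; split; lra.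
pose N := I 0 `|` (I (pi *+ 2) `|` I (- (pi *+ 2))).
have mI s : measurable (I s) by exact: measurable_arc.
have mN : measurable N by do 2?apply: measurableU => //.
have N0 : mu N = 0%E.
  apply: null_set_setU => //; first exact: measurableU.
    by apply: I0 => u; rewrite addr0.
  apply: null_set_setU => //; apply: I0 => u; first exact: f1mu2pi.
  by rewrite -f1mu2pi subrK.
have cosN x : angles x -> ~ N x -> cos (th - x) < cos d.
  rewrite /angles /= in_itv /= => Ax NN; have /andP[x1 x2] := Ax.
  have out s : I s `<=` N -> ~ (th + s - d <= x <= th + s + d).
    by move=> sN h; apply: NN; apply: sN; split; rewrite /angles /= ?in_itv.
  have out0 := out 0 (@subsetUl _ _ _).
  have outp := out (pi *+ 2) (fun y Iy => or_intror (or_introl Iy)).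
  have outm := out (- (pi *+ 2)) (fun y Iy => or_intror (or_intror Iy)).
  have [h1|h1] := leP `|th - x| d.
    move: h1; rewrite ler_norml => /andP[h1 h2]; exfalso; apply: out0.
    by apply/andP; split; lra.
  have y2 : `|th - x| < pi *+ 2 by rewrite ltr_norml mulr2n; apply/andP; split; lra.
  (* If |th - x| >= 2 pi - d, then x lies in the arc translated by -2 pi or 2 pi, according to the
     sign of th - x. *)
  apply: cos_lt_of_far => //; rewrite ltNge; apply/negP.
  have [yp|yn] := leP 0 (th - x); rewrite ?(ger0_norm yp) ?(ltr0_norm yn) in y2 * => h.
    by apply: outm; apply/andP; split; lra.
  by apply: outp; apply/andP; split; lra.
pose q := 1 + (1 - cos d) / 2.
have q1 : 1 < q.
  rewrite /q ltrDl divr_gt0// subr_gt0 -[ltRHS]cos0 ltr_cos// in_itv /= ?lexx ?ltW//.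
have : (q%:E * (f1mu mu th + f1mu mu th) <= f1mu mu (th + d) + f1mu mu (th - d))%E.
  have mA := @measurable_angles R.
  have mk l : measurable_fun (@angles R) (pkernel l) by exact: measurable_pkernel.
  have k0 l x : (0 <= pkernel l x :> \bar R)%E by exact: pkernel_ge0.
  rewrite /f1mu /Pint -!ge0_integralD// -ge0_integralZl_EFin//; last 3 first.
  - by move=> x _; rewrite adde_ge0.
  - exact: emeasurable_funD.
  - by rewrite ltW// (lt_trans ltr01).
  (* The pointwise inequality is available only off [N], so the integrals are compared almost
     everywhere. *)
  apply: ae_ge0_le_integral => //.
  - by move=> x _; rewrite mule_ge0 ?adde_ge0// lee_fin ltW// (lt_trans ltr01).
  - by apply: measurable_funeM; exact: emeasurable_funD.
  - by move=> x _; rewrite adde_ge0.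
  - exact: emeasurable_funD.
  exists N; split => // x /= hx; apply: contrapT => Nx; apply: hx => Ax.
  by apply: pkernel_convex => //; exact: cosN.
have Hp : (f1mu mu (th + d) <= M%:E)%E by apply: H; rewrite addrC addKr ger0_norm ?lexx// ltW.
have Hm : (f1mu mu (th - d) <= M%:E)%E.
  by apply: H; rewrite addrC addKr normrN ger0_norm ?lexx// ltW.
move=> /le_trans/(_ (leeD Hp Hm)); rewrite fth -EFinD -EFinM lee_fin.
nra.
Qed.

(** * Closure and interior of the region in the complex plane *)

Lemma ltr_norm_cplx {R : realType} (z : Cplx R) (d : R) :
  (`|z| < d%:C :> Cplx R) = (Normc.normc (z : R[i]) < d).
Proof. by case: z => a b; rewrite -ltcR. Qed.

(** Balls of [Cplx R] have radii in the field itself; a positive complex number has zero imaginary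
    part, so real radii suffice. *)
Lemma nbhs_cplx {R : realType} (lam : Cplx R) (B : set (Cplx R)) :
  nbhs lam B <-> exists2 d : R, 0 < d &
    forall z : R[i], Normc.normc (z - lam) < d -> B z.
Proof.
split => [/nbhs_normP[e /= e0 H]|[d d0 H]].
  case: e e0 H => a b; rewrite ltcE /= => /andP[/eqP -> a0] H.
  exists a => // z hz; apply: H; rewrite /ball_ /=.
  by rewrite (ltr_norm_cplx (lam - z)) normc_distC.
apply/nbhs_normP; exists (d%:C : Cplx R) => /=; first by rewrite ltcR.
move=> z; rewrite /ball_ /= (ltr_norm_cplx (lam - z)) normc_distC; exact: H.
Qed.

Lemma normc_expiB {R : realType} (x y : R) : Normc.normc (expi x - expi y) <= `|x - y|.
Proof.
rewrite -(ler_pXn2r (n := 2)) ?nnegrE ?normc_ge0// real_normK ?num_real//.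
rewrite /expi; simpc; rewrite normc_sqr; apply: le_trans (two_sub_2cos_le _).
rewrite cosB; have := cos2Dsin2 x; have := cos2Dsin2 y; lra.
Qed.

(** Positivity of p makes inversion order-reversing; at p = +oo the value 0 of [einv] agrees with 0
    < t. *)
Lemma einv_lt {R : realType} (p : \bar R) (t : R) : 0 < t -> (0 < p)%E ->
  (einv p < t) = ((t^-1)%:E < p)%E.
Proof.
by case: p => [p| |] t0 //= p0; rewrite ?ltry// lte_fin -[t in LHS]invrK ltf_pV2 ?posrE ?invr_gt0.
Qed.

Lemma einv_gt {R : realType} (p : \bar R) (t : R) : 0 < t -> (0 < p)%E ->
  (t < einv p) = (p < (t^-1)%:E)%E.
Proof.
case: p => [p| |] t0 //= p0; last by rewrite ltNge (ltW t0).
by rewrite lte_fin -[t in LHS]invrK ltf_pV2 ?posrE ?invr_gt0.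
Qed.

Section Topology.
Context {R : realType} (mu : probability R R) (hmu : mu (@angles R) = 1%E).
Context (t : R) (ht : 0 < t).

Let D : set (Cplx R) := Delta mu t.

Let DE (lam : R[i]) : D lam <-> lam != 0 /\ ((t^-1)%:E < pot mu lam)%E.
Proof. by rewrite /D DeltaE. Qed.

Let t0 : 0 < t^-1.
Proof. by rewrite invr_gt0. Qed.

Lemma closure_cplx (A : set (Cplx R)) (lam : R[i]) :
  (forall d, 0 < d -> exists2 z : R[i], A z & Normc.normc (z - lam) < d) ->
  closure A lam.
Proof.
by move=> h B /nbhs_cplx[d d0 H]; have [z Az zd] := h d d0; exists z; split => //; exact: H.
Qed.

Lemma closure_cplx_ex (A : set (Cplx R)) (lam : R[i]) (d : R) : 0 < d ->
  closure A lam -> exists2 z : R[i], A z & Normc.normc (z - lam) < d.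
Proof.
move=> d0 cA; have [|z [Az zd]] := cA [set z | Normc.normc ((z : R[i]) - lam) < d].
  by apply/nbhs_cplx; exists d.
by exists z.
Qed.

(** Only the level 1/t itself needs work. Off the circle, a small radial move toward the circle
    strictly raises the potential; on the circle, [f1mu_no_local_max] supplies nearby points of the
    circle with a larger value. *)
Lemma pot_ge_closure (lam : R[i]) : lam != 0 -> ((t^-1)%:E <= pot mu lam)%E ->
  closure D lam.
Proof.
move=> l0; rewrite le_eqVlt => /orP[/eqP E|h]; last first.
  by apply: subset_closure; apply/DE.
have [th thpi lE] := polarP _ l0; move: l0 E; rewrite lE -normc_gt0.
rewrite normc_polar ?normc_ge0//; move: (Normc.normc lam) => {lE lam} r r0 E.
apply: closure_cplx => d d0; have [r1|r1|r1] := ltgtP r 1.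
- pose s := Num.min ((r + 1) / 2) (r + d / 2).
  have rs : r < s by rewrite lt_min; apply/andP; split; lra.
  have s1 : s <= (r + 1) / 2 by rewrite ge_min lexx.
  have sd : s <= r + d / 2 by rewrite ge_min lexx orbT.
  exists (s%:C * expi th).
    apply/DE; split; first by rewrite polar_neq0// (lt_trans r0).
    by rewrite E; apply: pot_ltr => //; lra.
  by rewrite normc_polarB gtr0_norm; lra.
- pose s := Num.max ((r + 1) / 2) (r - d / 2).
  have rs : s < r by rewrite gt_max; apply/andP; split; lra.
  have s1 : (r + 1) / 2 <= s by rewrite le_max lexx.
  have sd : r - d / 2 <= s by rewrite le_max lexx orbT.
  have s0 : 0 < s by lra.
  exists (s%:C * expi th).
    apply/DE; split; first exact: polar_neq0.
    rewrite E -[ltLHS]potV// -[ltRHS]potV//; apply: pot_ltr => //.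
    + by rewrite invr_gt0.
    + by rewrite ltf_pV2.
    + by rewrite invf_le1//; lra.
  by rewrite normc_polarB ltr0_norm; lra.
- move: E; rewrite r1 -f1muE => /esym E.
  (* The cap 1 keeps the half-width below pi. *)
  pose e := Num.min 1 (d / 2).
  have e0 : 0 < e < pi.
    rewrite lt_min ltr01 divr_gt0//= gt_min; apply/orP; left.
    by have := pi_ge2 R; lra.
  have [u ud hu] := f1mu_no_local_max mu th e _ thpi e0 t0 E.
  exists (1%:C * expi u).
    by apply/DE; split; rewrite ?polar_neq0// -f1muE.
  rewrite !mul1r; apply: le_lt_trans (normc_expiB _ _) _.
  apply: le_lt_trans ud _; rewrite gt_min; apply/orP; right; lra.
Qed.

Lemma interior_off_circle (lam : R[i]) : Normc.normc lam != 1 -> D lam -> D° lam.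
Proof.
move=> l1 /DE[l0 h]; have [d d0 H] := pot_gt_near mu hmu _ _ l0 l1 t0 h.
have n0 : 0 < Normc.normc lam by rewrite normc_gt0.
apply/nbhs_cplx; exists (Num.min d (Normc.normc lam)); first by rewrite lt_min d0.
move=> z; rewrite lt_min => /andP[zd zn]; apply/DE; split; last exact: H.
by apply: contraTneq zn => ->; rewrite sub0r normcN ltxx.
Qed.

(** Continuity may fail on the circle, so it is used at an interior point r e^(i th) where the
    potential already exceeds 1/t. For z = s e^(iu) near e^(i th), the point r e^(iu) is close to r
    e^(i th), and r < s < 1/r makes the potential at z at least as large as at r e^(iu). *)
Lemma interior_on_circle (lam : R[i]) : Normc.normc lam = 1 -> D lam -> D° lam.
Proof.
move=> l1 /DE[l0 h]; have [th _ lE] := polarP _ l0.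
rewrite l1 mul1r in lE; rewrite lE in h *.
have [r /andP[r0 r1] hr] := pot_left_limit mu _ _ h.
have rn1 : Normc.normc (r%:C * expi th) != 1 by rewrite normc_polar ?(ltW r0)// lt_eqF.
have [d d0 H] := pot_gt_near mu hmu _ _ (polar_neq0 _ th r0) rn1 t0 hr.
(* The first bound gives |e^(iu) - e^(i th)| <= |1 - s| + |z - e^(i th)| < d. The second gives r < s
   < 2 - r, and r (2 - r) < 1. *)
apply/nbhs_cplx; exists (Num.min (d / 2) (1 - r)).
  by rewrite lt_min divr_gt0// subr_gt0.
move=> z; rewrite lt_min => /andP[zd zr].
have := le_lt_trans (ler_normcB z (expi th)) zr.
have := le_lt_trans (ler_normcB z (expi th)) zd.
rewrite normc_expi !ltr_norml => /andP[nd1 nd2] /andP[n1 n2].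
have n0 : 0 < Normc.normc z by lra.
have z0 : z != 0 by rewrite -normc_gt0.
apply/DE; split => //; have [u _ zE] := polarP _ z0.
rewrite [X in pot _ X]zE; move: zd; rewrite [X in X - _]zE; move: nd1 nd2 n0 n1 n2.
move: (Normc.normc z) => s sd1 sd2 s0 s1 s2 zd {zr}.
have hu : ((t^-1)%:E < pot mu (r%:C * expi u)%R)%E.
  apply: H; rewrite -mulrBr Normc.normcM normc_real gtr0_norm//.
  have -> : expi u - expi th = (1%:C * expi u - s%:C * expi u) + (s%:C * expi u - expi th).
    by rewrite mul1r subrKA.
  apply: (@le_lt_trans _ _ (`|1 - s| + Normc.normc (s%:C * expi u - expi th))).
    rewrite -(normc_polarB 1 s u).
    apply: le_trans (le_normcD _ _).
    by rewrite -[leRHS]mul1r ler_wpM2r ?normc_ge0// ltW.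
  have : `|1 - s| < d / 2 by rewrite ltr_norml; apply/andP; split; lra.
  lra.
apply: lt_le_trans hu _.
have [s1'|s1'] := leP s 1.
  apply/ltW/pot_ltr => //; lra.
rewrite -[leRHS]potV//; apply/ltW/pot_ltr => //.
  rewrite -[ltRHS]mul1r ltr_pdivlMr//; nra.
by rewrite invf_le1// ltW.
Qed.

End Topology.

Theorem theorem4p6 (R : realType) (mu : probability R R)
  (hmu : mu (@angles R) = 1%E) (t : R) (ht : 0 < t) :
  [/\ (fun lam : R[i] => (lam^*)^-1) @` Delta mu t = Delta mu t,
      Delta mu t = [set lam : R[i] | lam != 0 /\ Tmu mu lam < t],
      (forall lam : R[i], lam != 0 -> ~ closure (Delta mu t : set (Cplx R)) lam ->
         t < Tmu mu lam),
      (forall lam : R[i], boundary (Delta mu t : set (Cplx R)) lam -> Normc.normc lam = 1 ->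
         t <= Tmu mu lam) &
      (forall lam : R[i], lam != 0 -> boundary (Delta mu t : set (Cplx R)) lam ->
         Normc.normc lam != 1 -> Tmu mu lam = t)].
Proof.
have Tlt lam : lam != 0 -> (Tmu mu lam < t) = ((t^-1)%:E < pot mu lam)%E.
  by move=> l0; rewrite TmuE einv_lt// pot_gt0.
have Tgt lam : lam != 0 -> (t < Tmu mu lam) = (pot mu lam < (t^-1)%:E)%E.
  by move=> l0; rewrite TmuE einv_gt// pot_gt0.
have DT : Delta mu t = [set lam : R[i] | lam != 0 /\ Tmu mu lam < t].
  rewrite DeltaE//; apply/seteqP; split => lam [l0 h]; split => //; first by rewrite Tlt.
  by rewrite -Tlt.
have t0 : 0 < t^-1 by rewrite invr_gt0.
split=> //.
- exact: Delta_conjV.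
- move=> lam l0 nc; rewrite Tgt// ltNge; apply/negP => h.
  exact/nc/pot_ge_closure.
- move=> lam [_ ni] l1; rewrite leNgt; apply/negP => h; apply: ni.
  apply: interior_on_circle => //.
  by rewrite DT; split => //; rewrite -normc_gt0 l1.
(* If T > t at lam, continuity yields a neighbourhood disjoint from the region, against [cl]; if T <
   t, lam is an interior point, against [ni]. *)
- move=> lam l0 [cl ni] l1; apply/eqP; rewrite eq_le !leNgt; apply/andP; split; apply/negP => h.
    rewrite Tgt// in h; have [d d0 H] := pot_lt_near mu hmu _ _ l0 l1 t0 h.
    have [z] := closure_cplx_ex _ _ _ d0 cl.
    rewrite DeltaE// => -[_ hz] /H; apply/negP; rewrite -leNgt; exact: ltW.
  by apply: ni; apply: interior_off_circle => //; rewrite DT.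
Qed.
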